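(* Let $\mathcal{H}=\mathbb{C}^2$, $H=-\begin{pmatrix}0&1\\1&0\end{pmatrix}$, $t\in\mathbb{R}$, so that $$U_t=e^{-iHt}=\begin{pmatrix}\cos t& i\sin t\\ i\sin t&\cos t\end{pmatrix},$$ let $\psi=\begin{pmatrix}1\\0\end{pmatrix}$ and $\eta\in(0,1]$. Then the expected first return time $\tau_\infty(t,\eta)$ of $\psi$ to its initial site under infinitely many weak measurements with coupling strength $\eta$ is $$\tau_\infty(t,\eta)=\begin{cases}\dfrac1\eta,&\text{if } t=k\pi \text{ for some } k\in\mathbb{Z},\\[2mm] \dfrac2\eta,&\text{otherwise.}\end{cases}$$
   Context: Here $P=\begin{pmatrix}1&0\\0&0\end{pmatrix}$ is the projection onto the span of $\psi$, and $$P_\eta=\begin{pmatrix}\sqrt\eta&0\\0&0\end{pmatrix},\qquad Q_\eta=\begin{pmatrix}\sqrt{1-\eta}&0\\0&1\end{pmatrix}.$$ For $n\ge1$ let $\hat a_n^\eta(t)=P_\eta U_t\,(Q_\eta U_t)^{n-1}P$ and $p_n(\eta,t)=\|\hat a_n^\eta(t)\psi\|^2$ (probability of first detection at the $n$-th weak measurement). The expected first return time is $\tau_\infty(t,\eta)=\sum_{n=1}^\infty n\,p_n(\eta,t)$. *)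

(* Defs.v *)
From mathcomp Require Import all_boot all_order all_algebra.
From mathcomp Require Import all_classical all_reals all_analysis.
From mathcomp Require Import complex.

Set Implicit Arguments.
Unset Strict Implicit.
Unset Printing Implicit Defensive.

Import Order.TTheory GRing.Theory Num.Theory.
Import numFieldNormedType.Exports.

Local Open Scope classical_set_scope.
Local Open Scope ring_scope.
Local Open Scope complex_scope.

(* The limit is taken in the normed space of square matrices over [C]; the
   dimension is a successor because ['M[C]_m] is a normed space and a nonzero
   ring only for positive [m]. *)
Definition expmx (C : numFieldType) (m : nat) (A : 'M[C]_m.+1) : 'M[C]_m.+1 :=
  lim (series (fun k : nat => (k`!%:R)^-1 *: A ^+ k) @ \oo).

Section Definitions.
Variable R : realType.

Definition mx2 (a b c d : R[i]) : 'M[R[i]]_2 :=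
  \matrix_(i < 2, j < 2)
    if i == 0 then (if j == 0 then a else b) else (if j == 0 then c else d).

(* Euclidean norm of C^2; [ComplexField.Normc.normc] is the modulus, as an
   element of R. *)
Definition norm2 (v : 'cV[R[i]]_2) : R :=
  Num.sqrt (\sum_(i < 2) ComplexField.Normc.normc (v i ord0) ^+ 2).

Definition Hmx : 'M[R[i]]_2 := - mx2 0 1 1 0.

(* ['i%C] is [0 +i* 1]; without the scope key, ['i] under a ring operation is
   parsed as the generic imaginary unit of a closed field. *)
Definition U (t : R) : 'M[R[i]]_2 := expmx ((- 'i%C * t%:C) *: Hmx).

Definition psi : 'cV[R[i]]_2 := \col_(i < 2) if i == 0 then 1 else 0.

Definition P : 'M[R[i]]_2 := mx2 1 0 0 0.

Definition Peta (eta : R) : 'M[R[i]]_2 := mx2 (Num.sqrt eta)%:C 0 0 0.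

Definition Qeta (eta : R) : 'M[R[i]]_2 := mx2 (Num.sqrt (1 - eta))%:C 0 0 1.

(* Only meaningful for 1 <= n. *)
Definition ahat (n : nat) (eta t : R) : 'M[R[i]]_2 :=
  Peta eta *m U t *m (Qeta eta *m U t) ^+ n.-1 *m P.

Definition prob (n : nat) (eta t : R) : R := norm2 (ahat n eta t *m psi) ^+ 2.

(* All terms are nonnegative, so the series is defined in [0, +oo]. *)
Definition tau_infty (t eta : R) : \bar R :=
  (\sum_(1 <= n <oo) (n%:R * prob n eta t)%:E)%E.

End Definitions.

Arguments Hmx {R}.
Arguments psi {R}.
Arguments P {R}.

(* Main.v *)
(** The detection probability at step [n + 1] is the loss [N n - N (n + 1)] of
    the squared norm of the undetected state, so summation by parts gives
    [tau_infty = \sum_n N n].  The undetected state evolves by the linear map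
    [Q_eta U_t], and the sum is read off a quadratic form [V] solving the
    Lyapunov equation [V v - V (Q_eta U_t v) = |v|^2]: it is [V psi].  When
    [sin t <> 0] the trace of this equation alone forces [V psi = 2 / eta];
    when [sin t = 0] the orbit stays on the line of [psi], where the form
    [|v|^2 / eta] does. *)
Require Import Defs.
From mathcomp Require Import all_boot all_order all_algebra.
From mathcomp Require Import all_classical all_reals all_analysis.
From mathcomp Require Import complex ring lra.

Set Implicit Arguments.
Unset Strict Implicit.
Unset Printing Implicit Defensive.

Import Order.TTheory GRing.Theory Num.Theory.
Import numFieldNormedType.Exports.

Local Open Scope classical_set_scope.
Local Open Scope ring_scope.
Local Open Scope complex_scope.

(** * Zeros of the sine *)

Lemma sin_intMpi (R : realType) (a : R) (k : int) :
  sin (a + k%:~R * pi) = (-1) ^+ `|k|%N * sin a.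
Proof.
have sinN n b : sin (b + n%:R * pi) = (-1) ^+ n * sin b :> R.
  by rewrite mulr_natl; exact: (alternatingn (@sinDpi R)).
case: k => n /=; first by rewrite sinN.
rewrite NegzE mulrNz -[n.+1%:~R]/(n.+1%:R).
rewrite -[a in RHS](subrK (n.+1%:R * pi)) -mulNr sinN mulrA -exprD addnn.
by rewrite -muln2 exprM sqrr_sign mul1r.
Qed.

(** Subtracting a multiple of [pi] moves [t] into [[0, pi)] and changes the sine only by a sign;
    there the sine is positive except at 0. *)
Lemma sin_eq0 (R : realType) (t : R) :
  sin t = 0 <-> exists k : int, t = k%:~R * pi.
Proof.
split=> [st0|[k ->]]; last by rewrite -[_ * _]add0r sin_intMpi sin0 mulr0.
exists (Num.floor (t / pi)); set k := Num.floor _.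
have pi0 := pi_gt0 R.
have /andP[kt tk] := floor_itv (t / pi).
pose u := t - k%:~R * pi.
have su0 : sin u = 0.
  apply/eqP; move: st0; rewrite -[t](subrK (k%:~R * pi)) sin_intMpi => /eqP.
  by rewrite mulf_eq0 signr_eq0.
have u0 : 0 <= u by rewrite subr_ge0 -ler_pdivlMr.
have upi : u < pi.
  by move: tk; rewrite ltr_pdivrMr// intrD mulrDl mul1r ltrBlDr addrC.
apply/eqP; rewrite -subr_eq0 -/u eq_le u0 andbT leNgt; apply/negP => u_gt0.
by have := @sin_gt0_pi R u; rewrite u_gt0 upi su0 ltxx => /(_ isT).
Qed.

Lemma cvg_real_complex (R : realType) (u : nat -> R) (l : R) :
  u @ \oo --> l ->
  (fun n => (u n)%:C : (R[i] : numFieldType)) @ \oo --> (l%:C : (R[i] : numFieldType)).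
Proof.
move=> /cvgrPdist_lt ul; apply/cvgrPdist_lt => e.
rewrite ltcE/= => /andP[/eqP e0 e_gt0].
near=> n.
rewrite -rmorphB normc_def /= expr0n addr0 sqrtr_sqr ltcE /= e0 eqxx /=.
by near: n; exact: ul.
Unshelve. all: by end_near. Qed.

(** * Matrix arithmetic and the closed form of the evolution *)

Section TwoByTwo.
Variable R : realType.
Implicit Types a b c d u v : R[i].

Definition col2 u v : 'cV[R[i]]_2 := \col_(i < 2) if i == 0 then u else v.

Lemma mx2_mul a b c d a' b' c' d' :
  mx2 a b c d *m mx2 a' b' c' d' =
  mx2 (a * a' + b * c') (a * b' + b * d') (c * a' + d * c') (c * b' + d * d').
Proof.
apply/matrixP => i j; rewrite !mxE big_ord_recl big_ord1 !mxE /=.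
by case: ifP; case: ifP.
Qed.

Lemma mx2_mul_col2 a b c d u v :
  mx2 a b c d *m col2 u v = col2 (a * u + b * v) (c * u + d * v).
Proof.
apply/matrixP => i j; rewrite !mxE big_ord_recl big_ord1 !mxE /=.
by case: ifP.
Qed.

Lemma norm2_col2 u v :
  norm2 (col2 u v) ^+ 2 =
  ComplexField.Normc.normc u ^+ 2 + ComplexField.Normc.normc v ^+ 2.
Proof.
rewrite /norm2 big_ord_recl big_ord1 !mxE /= sqr_sqrtr//.
by rewrite addr_ge0// sqr_ge0.
Qed.

Lemma mx2_lin (x y : R[i]) :
  mx2 x y y x = x *: (1 : 'M[R[i]]_2) + y *: mx2 0 1 1 0.
Proof.
apply/matrixP => i j; rewrite !mxE.
by case: i => [[|[|]]] //= ?; case: j => [[|[|]]] //= ?;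
  rewrite ?(mulr0, mulr1, addr0, add0r).
Qed.

Lemma flip_sqr : mx2 0 1 1 0 ^+ 2 = 1 :> 'M[R[i]]_2.
Proof.
rewrite expr2 -mulmxE mx2_mul !(mulr0, mulr1, mul0r, addr0, add0r).
by rewrite mx2_lin scale0r addr0 scale1r.
Qed.

(** The flip squares to the identity and ['i%C] to -1, so even powers give real multiples of the
    identity and odd powers imaginary multiples of the flip. *)
Lemma expmx_flip_term (t : R) k :
  (k`!%:R)^-1 *: (('i%C * t%:C) *: mx2 0 1 1 0) ^+ k =
  (cos_coeff t k)%:C *: (1 : 'M[R[i]]_2) +
    ('i%C * (sin_coeff t k)%:C) *: mx2 0 1 1 0.
Proof.
rewrite exprZn scalerA exprMn -!rmorphXn /= /cos_coeff /sin_coeff /=.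
rewrite -[k in 'i%C ^+ k]odd_double_half -[k in mx2 _ _ _ _ ^+ k]odd_double_half.
(* [k.-1./2] equals [k./2] for odd [k]; for even [k] the factor [odd k] kills both sides. *)
have -> : (odd k)%:R * (-1) ^+ k.-1./2 * t ^+ k / k`!%:R =
          (odd k)%:R * (-1) ^+ k./2 * t ^+ k / k`!%:R :> R.
  case ok : (odd k); last by rewrite !mul0r.
  by rewrite -[k in LHS]odd_double_half -[k in RHS]odd_double_half ok /=
    add1n /= doubleK uphalf_double.
rewrite !exprD -!muln2 ![(_ * 2)%N]mulnC !exprM sqr_i flip_sqr expr1n mulr1.
case: (odd k) => /=;
  rewrite ?expr1 ?expr0 !(mul0r, mul1r, rmorph0, scale0r, addr0, add0r, mulr0) /=.
  by congr (_ *: _); rewrite !(rmorphM, rmorphXn, rmorphN, rmorph1, fmorphV, rmorph_nat) /=; ring.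
by congr (_ *: _); rewrite !(rmorphM, rmorphXn, rmorphN, rmorph1, fmorphV, rmorph_nat) /=; ring.
Qed.

Lemma UE (t : R) :
  U t = mx2 (cos t)%:C ('i%C * (sin t)%:C) ('i%C * (sin t)%:C) (cos t)%:C.
Proof.
rewrite /U /expmx; apply: (@cvg_lim _ (@norm_hausdorff (R[i] : numFieldType) 'M[R[i]]_2)).
rewrite mx2_lin.
have -> : (- 'i%C * t%:C) *: Hmx = ('i%C * t%:C) *: mx2 0 1 1 0 :> 'M[R[i]]_2.
  by rewrite /Hmx scalerN mulNr scaleNr opprK.
have -> : series (fun k => (k`!%:R)^-1 *: (('i%C * t%:C) *: mx2 0 1 1 0) ^+ k) =
  (fun n => (series (cos_coeff t) n)%:C *: (1 : 'M[R[i]]_2) +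
    ('i%C * (series (sin_coeff t) n)%:C) *: mx2 0 1 1 0).
  apply/funext => n; rewrite /series /= (eq_bigr _ (fun k _ => expmx_flip_term t k)).
  by rewrite big_split /= -!scaler_suml -mulr_sumr !rmorph_sum.
apply: cvgD; apply: cvgZr_tmp.
  by apply: cvg_real_complex; rewrite cos.unlock; exact: is_cvg_series_cos_coeff.
apply: (@cvgMl_tmp (R[i] : numFieldType)); apply: cvg_real_complex.
by rewrite sin.unlock; exact: is_cvg_series_sin_coeff.
Qed.

End TwoByTwo.

(** * The undetected state as a real orbit *)

Section Orbit.
Variable R : realType.
Implicit Types (q c s : R) (v : R * R).

(* [Q_eta U_t] in the basis [(1, 0), (0, i)], where it is real. *)
Definition survive q c s v : R * R :=
  (q * (c * v.1 - s * v.2), s * v.1 + c * v.2).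

Definition sqnorm v : R := v.1 ^+ 2 + v.2 ^+ 2.

Definition orbit q c s n : R * R := iter n (survive q c s) (1, 0).

Lemma survive_orbit (eta t : R) n :
  let v := orbit (Num.sqrt (1 - eta)) (cos t) (sin t) n in
  (Qeta eta *m U t) ^+ n *m psi = col2 v.1%:C ('i%C * v.2%:C).
Proof.
elim: n => [|n IHn] /=.
  by rewrite expr0 mul1mx rmorph0 mulr0 rmorph1.
rewrite exprS -mulmxE -mulmxA IHn -mulmxA UE /Qeta !mx2_mul_col2 /=.
set v := orbit _ _ _ n; rewrite !mul0r mul1r addr0 add0r.
congr col2; rewrite !(rmorphM, rmorphB, rmorphD) /=; last by ring.
have -> : 'i%C * (sin t)%:C * ('i%C * (v.2)%:C) = 'i%C ^+ 2 * ((sin t)%:C * (v.2)%:C) :> R[i].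
  by ring.
by rewrite sqr_i mulN1r.
Qed.

(* The detection probability is the loss of survival probability. *)
Lemma probS (eta t : R) n (heta : 0 < eta <= 1) :
  let v := orbit (Num.sqrt (1 - eta)) (cos t) (sin t) in
  prob n.+1 eta t = sqnorm (v n) - sqnorm (v n.+1).
Proof.
move=> v; have /andP[eta0 eta1] := heta.
rewrite /prob /ahat /=.
have P_psi : P *m psi = psi :> 'cV[R[i]]_2.
  rewrite [psi](_ : _ = col2 1 0)// /P mx2_mul_col2.
  by rewrite !(mulr0, mul0r, mulr1, addr0).
rewrite -[_ *m psi]mulmxA P_psi -[_ *m psi]mulmxA survive_orbit /= -/(v n).
rewrite -mulmxA UE /Peta !mx2_mul_col2 norm2_col2 !mul0r !addr0.
rewrite ComplexField.Normc.normc0 expr0n addr0.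
have -> : (cos t)%:C * ((v n).1)%:C + 'i%C * (sin t)%:C * ('i%C * ((v n).2)%:C) =
  (cos t * (v n).1 - sin t * (v n).2)%:C :> R[i].
  rewrite rmorphB !rmorphM /= -mulN1r -sqr_i; ring.
rewrite -rmorphM /= expr0n addr0 sqrtr_sqr -normrX ger0_norm ?sqr_ge0//.
rewrite exprMn sqr_sqrtr ?ltW// /sqnorm /= exprMn sqr_sqrtr ?subr_ge0//.
have c2 := cos2Dsin2 t; rewrite -/(v n).
(* Inserting [cos t ^+ 2 + sin t ^+ 2] turns norm preservation under the rotation into a polynomial
   identity. *)
have -> : (v n).1 ^+ 2 + (v n).2 ^+ 2 = (cos t ^+ 2 + sin t ^+ 2) * ((v n).1 ^+ 2 + (v n).2 ^+ 2).
  by rewrite c2 mul1r.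
by ring.
Qed.

End Orbit.

(** * Summation by a Lyapunov function *)

Section Lyapunov.
Variable R : realType.

(** Each of the [n.+1] terms of the geometric sum up to [z ^+ n] is at least [z ^+ n]. *)
Lemma succMexpr_le (z : R) n : 0 <= z < 1 -> n.+1%:R * z ^+ n <= (1 - z)^-1.
Proof.
move=> /andP[z0 z1]; have z1' : 0 < 1 - z by rewrite subr_gt0.
rewrite -[leRHS]mul1r ler_pdivlMr//.
suff : n.+1%:R * z ^+ n * (1 - z) <= 1 - z ^+ n.+1.
  by move/le_trans; apply; rewrite gerBl exprn_ge0.
elim: n => [|n IHn]; first by rewrite expr0 !mul1r expr1.
have zn0 : 0 <= z ^+ n.+1 by rewrite exprn_ge0.
have zn1 : z ^+ n.+1 <= 1 by rewrite exprn_ile1// ltW.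
have h1 := ler_wpM2l z0 IHn.
have h2 : 0 <= (1 - z) * (1 - z ^+ n.+1) by rewrite mulr_ge0 ?subr_ge0// ltW.
move: h1 h2; rewrite -(natr1 n.+1) (exprS z n.+1) !(exprS z n).
by move: (z ^+ n) (n.+1%:R : R) => y m; lra.
Qed.

(** With [z] the square root of [r], one factor [z ^+ n] absorbs [n.+1] and the other tends to 0. *)
Lemma cvg_succMexpr (r : R) : 0 <= r < 1 ->
  n.+1%:R * r ^+ n @[n --> \oo] --> (0 : R).
Proof.
move=> /andP[r0 r1]; pose z := Num.sqrt r.
have z0 : 0 <= z by rewrite sqrtr_ge0.
have rE : r = z * z by rewrite -expr2 sqr_sqrtr.
have z1 : z < 1 by rewrite -sqrtr1 ltr_sqrt.
have zn : `|z| < 1 by rewrite ger0_norm.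
apply: (@squeeze_cvgr _ _ _ _ (fun=> 0) (fun n => (1 - z)^-1 * z ^+ n)).
- near=> n; rewrite rE exprMn mulrA; apply/andP; split.
    by rewrite !mulr_ge0// ?exprn_ge0.
  by apply: ler_wpM2r; [rewrite exprn_ge0|apply: succMexpr_le; rewrite z0].
- exact: cvg_cst.
- by rewrite -(mulr0 (1 - z)^-1); apply: cvgMl_tmp; exact: cvg_expr.
Unshelve. all: by end_near. Qed.

(* [V] is a Lyapunov function along a trajectory with squared norms [N]:
   summation by parts turns the partial sum into [V 0 - V n - n N_n], and
   [V] decays geometrically. *)
Lemma cvg_sum_succM_decrement (N V : nat -> R) (C : R) :
  1 <= C -> (forall n, 0 <= N n) -> (forall n, 0 <= V n <= C * N n) ->
  (forall n, V n.+1 = V n - N n) ->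
  \sum_(0 <= k < n) k.+1%:R * (N k - N k.+1) @[n --> \oo] --> V 0%N.
Proof.
move=> C1 N0 V0 VS.
have C0 : 0 < C by rewrite (lt_le_trans _ C1).
have sumE n : \sum_(0 <= k < n) k.+1%:R * (N k - N k.+1) =
    V 0%N - (V n + n%:R * N n).
  elim: n => [|n IHn]; first by rewrite big_nil mul0r addr0 subrr.
  by rewrite big_nat_recr// IHn /= VS -natr1; ring.
(* Since [N n >= V n / C], each step shrinks [V] by at least the factor [1 - C^-1]. *)
have Vle n : V n <= (1 - C^-1) ^+ n * V 0%N.
  elim: n => [|n IHn]; first by rewrite mul1r.
  rewrite VS exprS -mulrA; apply: (le_trans _ (ler_wpM2l _ IHn)); last first.
    by rewrite subr_ge0 invf_le1.
  rewrite mulrBl mul1r lerD2l lerN2 mulrC ler_pdivrMr// mulrC.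
  by case/andP: (V0 n).
(* Nonnegativity of [V n.+1] bounds [N n] by [V n], so [n%:R * N n] vanishes in the limit too. *)
have NV n : N n <= V n by have := V0 n.+1; rewrite VS subr_ge0 => /andP[].
rewrite (_ : (fun n => _) = (fun n => V 0%N - (V n + n%:R * N n))); last exact/funext.
rewrite -[X in _ --> X]subr0; apply: cvgB; first exact: cvg_cst.
apply: (@squeeze_cvgr _ _ _ _ (fun=> 0)
  (fun n => n.+1%:R * (1 - C^-1) ^+ n * V 0%N)).
- near=> n; rewrite addr_ge0 ?mulr_ge0//=; last by case/andP: (V0 n).
  rewrite -natr1 addrC -mulrA mulrDl mul1r lerD// ler_wpM2l//.
  exact: le_trans (NV n) (Vle n).
- exact: cvg_cst.
- rewrite -(mul0r (V 0%N)); apply: cvgMr_tmp; apply: cvg_succMexpr.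
  by rewrite subr_ge0 invf_le1// C1 /= gtrBl invr_gt0.
Unshelve. all: by end_near. Qed.

Lemma tau_infty_lyapunov (eta t C : R) (V : R * R -> R) (heta : 0 < eta <= 1) :
  let v := orbit (Num.sqrt (1 - eta)) (cos t) (sin t) in
  1 <= C -> (forall n, 0 <= V (v n) <= C * sqnorm (v n)) ->
  (forall n, V (v n.+1) = V (v n) - sqnorm (v n)) ->
  tau_infty t eta = (V (1, 0))%:E.
Proof.
move=> v C1 V0 VS; rewrite /tau_infty.
apply/cvg_lim => //.
rewrite -cvg_shiftS.
have -> : (fun n => \sum_(1 <= k < n.+1) (k%:R * prob k eta t)%:E)%E =
   EFin \o (fun n => \sum_(0 <= k < n) k.+1%:R * (sqnorm (v k) - sqnorm (v k.+1))).
  apply/funext => n /=; rewrite -sumEFin big_add1 /=.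
  by apply: eq_bigr => k _; rewrite probS.
apply: cvg_EFin; first by near=> n.
apply: (@cvg_sum_succM_decrement (fun n => sqnorm (v n)) (fun n => V (v n)) C C1 _ V0 VS).
by move=> n; rewrite addr_ge0 ?sqr_ge0.
Unshelve. all: by end_near. Qed.

(** The second coordinate stays 0 and each step multiplies the squared norm by [1 - eta]; the upper
    bound holds with equality for the constant [eta^-1]. *)
Lemma tau_infty_sin0 (eta t : R) (heta : 0 < eta <= 1) :
  sin t = 0 -> tau_infty t eta = (1 / eta)%:E.
Proof.
move=> s0; have /andP[eta0 eta1] := heta.
have c2 : cos t ^+ 2 = 1 by have := cos2Dsin2 t; rewrite s0 expr0n addr0.
set v := orbit (Num.sqrt (1 - eta)) (cos t) (sin t).
have v2 n : (v n).2 = 0.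
  by elim: n => [//|n IHn] /=; rewrite -/(v n) IHn s0 mul0r mulr0 addr0.
rewrite (@tau_infty_lyapunov _ _ eta^-1 (fun w => w.1 ^+ 2 / eta) heta) /=.
- by rewrite expr1n.
- by rewrite invf_ge1.
- move=> n; rewrite -/v divr_ge0 ?sqr_ge0 ?(ltW eta0)//=.
  by rewrite /sqnorm v2 expr0n addr0 mulrC.
- move=> n; rewrite -/v -/(v n) /sqnorm v2 s0 mul0r subr0 !exprMn c2 mul1r.
  by rewrite sqr_sqrtr ?subr_ge0// expr0n addr0; field; rewrite gt_eqF.
Qed.

(** Only the coefficients [b] and [d] of the form divide by [s]; the value at [(1, 0)] is [a], which
    is independent of [t]. *)
Lemma tau_infty_sin_neq0 (eta t : R) (heta : 0 < eta <= 1) :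
  sin t != 0 -> tau_infty t eta = (2 / eta)%:E.
Proof.
move=> s0; have /andP[eta0 eta1] := heta.
set q := Num.sqrt (1 - eta); set c := cos t; set s := sin t.
have q2 : q ^+ 2 = 1 - eta by rewrite sqr_sqrtr ?subr_ge0.
have q0 : 0 <= q by rewrite sqrtr_ge0.
have q1 : q < 1 by rewrite -sqrtr1 ltr_sqrt// gtrBl.
have etaE : eta = (1 - q) * (1 + q).
  by transitivity (1 - q ^+ 2); [rewrite q2|]; ring.
have c2s2 : c ^+ 2 = 1 - s ^+ 2 by rewrite -(cos2Dsin2 t) addrK.
have q1p : 1 + q != 0 by rewrite gt_eqF// ltr_pwDl.
have q1n : 1 - q != 0 by rewrite gt_eqF// subr_gt0.
(* [a], [b], [d] solve the three scalar equations [xx], [xy], [yy] below. *)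
pose a := 2 / eta.
pose b := c / (s * (1 + q)).
pose d := (1 + a * q ^+ 2 * s ^+ 2 - 2 * q * c ^+ 2 / (1 + q)) / s ^+ 2.
pose V (w : R * R) := a * w.1 ^+ 2 + 2 * b * w.1 * w.2 + d * w.2 ^+ 2.
have a2 : 2 <= a by rewrite ler_pdivlMr// ler_piMr.
have a0 : 0 < a by apply: lt_le_trans a2.
(* With [a > 0], a positive determinant makes [V] positive definite, by completing the square. *)
have det0 : 0 < a * d - b ^+ 2.
  have -> : a * d - b ^+ 2 = (s * (1 + q)) ^- 2 + (1 - q) ^- 2.
    rewrite /d /b expr_div_n c2s2 /a etaE; field.
    by rewrite s0 q1p q1n.
  by rewrite addr_gt0// invr_gt0 exprn_even_gt0//= mulf_neq0.
have d0 : 0 < d.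
  by rewrite -(pmulr_rgt0 _ a0) (le_lt_trans (sqr_ge0 b))// -subr_gt0.
have Vge0 w : 0 <= V w.
  rewrite -(pmulr_rge0 _ a0).
  have -> : a * V w = (a * w.1 + b * w.2) ^+ 2 + (a * d - b ^+ 2) * w.2 ^+ 2.
    by rewrite /V; ring.
  by rewrite addr_ge0 ?sqr_ge0// mulr_ge0 ?sqr_ge0// ltW.
(* The trace times the identity minus the matrix of [V] is its adjugate, whose form is [V] after a
   quarter turn, hence nonnegative. *)
have Vle w : V w <= (a + d) * sqnorm w.
  rewrite -subr_ge0.
  have -> : (a + d) * sqnorm w - V w = V (- w.2, w.1) by rewrite /V /sqnorm /=; ring.
  exact: Vge0.
rewrite (@tau_infty_lyapunov _ _ (a + d) V heta) //=.
- by rewrite /V /= expr1n expr0n !mulr0 !addr0 mulr1.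
- lra.
- by move=> n; rewrite Vge0 Vle.
- move=> n; rewrite -/q -/c -/s; case: (orbit q c s n) => x y.
  rewrite /V /sqnorm /=.
  have bs : b * s * (1 + q) = c by rewrite /b; field; rewrite s0 q1p.
  have ds : d * s ^+ 2 = 1 + a * q ^+ 2 * s ^+ 2 - 2 * q * c * (b * s).
    by rewrite /d /b; field; rewrite s0 q1p.
  have aq : a * (1 - q ^+ 2) = 2.
    by rewrite q2 /a; field; rewrite gt_eqF.
  have xx : a - (a * q ^+ 2 * c ^+ 2 + 2 * b * q * c * s + d * s ^+ 2) = 1.
    by rewrite ds c2s2; lra.
  have yy : d - (a * q ^+ 2 * s ^+ 2 - 2 * b * q * s * c + d * c ^+ 2) = 1.
    by rewrite c2s2; lra.
  have xy : b = b * q * (c ^+ 2 - s ^+ 2) + d * s * c - a * q ^+ 2 * c * s.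
    (* After multiplication by [s], the unknowns occur only as [b * s] and [d * s ^+ 2], known from
       [bs] and [ds]. *)
    apply: (mulIf s0); rewrite -/s.
    transitivity (c - b * s * q * (c ^+ 2 + s ^+ 2)).
      by rewrite cos2Dsin2 -[c in RHS]bs; ring.
    transitivity (b * s * q * (c ^+ 2 - s ^+ 2) + d * s ^+ 2 * c
      - a * q ^+ 2 * c * s ^+ 2); last by ring.
    by rewrite ds; ring.
  (* The Lyapunov equation at [(x, y)] combines the three coefficient identities with weights
     [x ^+ 2], [y ^+ 2] and [2 * x * y]. *)
  have := congr1 ( *%R^~ (x ^+ 2)) xx.
  have := congr1 ( *%R^~ (y ^+ 2)) yy.
  have := congr1 ( *%R^~ (2 * x * y)) xy.
  by move=> /=; lra.
Qed.

End Lyapunov.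

Theorem mainTheorem3 (R : realType) (t eta : R) (heta : 0 < eta <= 1) :
  U t = mx2 (cos t)%:C ('i%C * (sin t)%:C) ('i%C * (sin t)%:C) (cos t)%:C /\
  tau_infty t eta =
    (if `[< exists k : int, t = k%:~R * pi >] then 1 / eta else 2 / eta)%:E.
Proof.
split; first exact: UE.
case: asboolP => [/sin_eq0|tpi]; first exact: tau_infty_sin0.
by apply: tau_infty_sin_neq0 => //; apply/eqP => /sin_eq0.
Qed.
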